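(* Let a problem domain be given, consisting of $N$ robots, $M$ tasks, a team trait matrix $\mathbf{Q}\in\mathbb{R}_{\ge 0}^{N\times U}$, trait-efficacy maps $\xi_m:\mathbb{R}_{\ge 0}^U\to[0,1]$ ($m=1,\dots,M$), scheduling data assigning to each allocation $\mathbf{A}\in\{0,1\}^{M\times N}$ a makespan $C_{\mathbf{A}}\in\mathbb{R}$, and a time budget $C_{max}$. Let $\Xi(\mathbf{A})=\sum_{m=1}^M\xi_m(\mathbf{Q}^{T}\mathbf{A}_m^{T})$ denote the total allocation efficacy, where $\mathbf{A}_m$ is the $m$-th row of $\mathbf{A}$. Assume that adding a robot never reduces a coalition's performance: for every task $m$ and all coalitions $v,w\in\{0,1\}^{1\times N}$ with $v\le w$ entrywise, $\xi_m(\mathbf{Q}^Tv^T)\le\xi_m(\mathbf{Q}^Tw^T)$. Let $\mathbf{A}^*$ be an optimal allocation with respect to total allocation efficacy for this problem, i.e. a maximizer of $\Xi$ among the allocations $\mathbf{A}\in\{0,1\}^{M\times N}$ with $C_{\mathbf{A}}\le C_{max}$, and let $\hat{\mathbf{A}}$ be the allocation of the solution generated by E-ITAGS (the greedy best-first search defined in the context) for the same problem, run with parameter $\alpha$. If $0\le\alpha<0.5$, then $$\Xi(\mathbf{A}^* )-\Xi(\hat{\mathbf{A}})\;\le\;\frac{\alpha}{1-\alpha}\,\bigl(\Xi(\mathbf{A}_{\text{root}})-\Xi(\mathbf{A}_{\text{null}})\bigr),$$ where $\mathbf{A}_{\text{root}}$ is the all-ones matrix (all robots assigned to all tasks) and $\mathbf{A}_{\text{null}}$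 is the zero matrix (no robot assigned to any task). Additionally, when $\alpha=0$, E-ITAGS gives an optimal solution, i.e. $\Xi(\mathbf{A}^* )-\Xi(\hat{\mathbf{A}})=0$.
   Context: **Allocations.** An allocation is a binary matrix $\mathbf{A}\in\{0,1\}^{M\times N}$, with $\mathbf{A}_{mn}=1$ iff robot $n$ is assigned to task $m$. Row $i$ of $\mathbf{Q}$ is the trait vector of robot $i$, so $\mathbf{Q}^T\mathbf{A}_m^T\in\mathbb{R}_{\ge0}^U$ is the vector of aggregated traits of the coalition assigned to task $m$. **Makespan.** Each allocation $\mathbf{A}$ has an associated schedule with makespan $C_{\mathbf{A}}$, the optimal value of the mixed-integer linear program $$\min_{\{s_i\},\{p_{ij}\}} C\quad\text{s.t. } C\ge s_i+d_i\ \forall i;\quad s_j\ge s_i+d_i+x_{ij}\ \forall(i,j)\in\mathcal{P};\quad s_i\ge x_i\ \forall i;$$ $$s_i\ge s_j+d_j+x_{ji}-\beta p_{ij},\quad s_j\ge s_i+d_i+x_{ij}-\beta(1-p_{ij})\ \ \forall(i,j)\in\mathcal{M}^R,$$ where $s_i$ and $d_i$ are the start time and duration of task $i$; $x_i$ is the initial travel time of the coalition assigned by $\mathbf{A}$ to the site of task $i$; $x_{ij}$ is the travel time from the site of task $i$ to that of task $j$; $p_{ij}\in\{0,1\}$; $\beta>0$ is a large constant; $\mathcal{P}$ is the set of precedence constraints; $\mathcal{M}$ is the set of mutex (non-concurrency) constraints; and $\mathcal{M}^R=\mathcal{M}\setminus(\mathcal{P}\cap\mathcal{M})$. The only facts about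 makespans relevant to the claim are that $C_{\mathbf{A}}$ is a well-defined real number for each allocation and that the schedule for $\mathbf{A}_{\text{root}}$ is the longest one: writing $C_{worst}=C_{\mathbf{A}_{\text{root}}}$, one has $C_{\mathbf{A}}\le C_{worst}$ for every allocation $\mathbf{A}$. **Heuristics.** For a user-specified parameter $\alpha\in[0,1]$ define $$f_{NAC}(\mathbf{A})=\frac{\Xi(\mathbf{A}_{\text{root}})-\Xi(\mathbf{A})}{\Xi(\mathbf{A}_{\text{root}})-\Xi(\mathbf{A}_{\text{null}})},\qquad f_{TBO}(\mathbf{A})=\max\left(\frac{C_{\mathbf{A}}-C_{max}}{|C_{worst}-C_{max}|},\,0\right),$$ $$f_{TETAM}(\mathbf{A})=(1-\alpha)f_{NAC}(\mathbf{A})+\alpha f_{TBO}(\mathbf{A}).$$ The denominators are assumed nonzero, i.e. $\Xi(\mathbf{A}_{\text{root}})\neq\Xi(\mathbf{A}_{\text{null}})$ and $C_{worst}\ne C_{max}$. **E-ITAGS.** The search graph has all allocations as nodes. The children of a node are the allocations obtained from it by changing exactly one entry from $1$ to $0$ (removing a single robot from a single task). E-ITAGS performs greedy best-first search with evaluation function $f_{TETAM}$. The open set initially contains only $\mathbf{A}_{\text{root}}$. At each step a node with minimal $f_{TETAM}$ value among all nodes in the open set is selected (ties broken arbitrarily). If the selected node respects the time budget ($C_{\mathbf{A}}\le C_{max}$, equivalently $f_{TBO}(\mathbf{A})=0$), the search stops and returns it as the solution $\hat{\mathbf{A}}$. Otherwise it is removed from the open set and all its children that have not been generated before are added to the open set.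 If the open set becomes empty, infeasibility is reported. The claim concerns problems for which a solution is returned. *)

(* Defs.v *)
From HB Require Import structures.
From mathcomp Require Import all_boot all_order all_algebra.
From mathcomp Require Import reals.

Set Implicit Arguments.
Unset Strict Implicit.
Unset Printing Implicit Defensive.

Import Order.TTheory GRing.Theory Num.Theory.
Local Open Scope ring_scope.

(* Rows are tasks, columns are robots. *)
Notation allocation M N := 'M[bool]_(M, N).

Definition alloc_root (M N : nat) : allocation M N := const_mx true.
Definition alloc_null (M N : nat) : allocation M N := const_mx false.

Definition coalition_traits (R : realType) (N U : nat) (Q : 'M[R]_(N, U))
    (v : 'rV[bool]_N) : 'cV[R]_U :=
  Q^T *m (map_mx (fun b : bool => b%:R) v)^T.

Definition total_efficacy (R : realType) (M N U : nat) (Q : 'M[R]_(N, U))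
    (xi : 'I_M -> 'cV[R]_U -> R) (A : allocation M N) : R :=
  \sum_(m < M) xi m (coalition_traits Q (row m A)).

(* The data of the scheduling program of one allocation.  All fields may vary
   with the allocation; data shared by all allocations is the constant case. *)
Record schedule_data (R : realType) (M : nat) := ScheduleData {
  duration : 'I_M -> R;
  init_travel : 'I_M -> R;
  travel : 'I_M -> 'I_M -> R;
  big_beta : R;
  precedence : {set 'I_M * 'I_M};
  mutex : {set 'I_M * 'I_M}
}.

Definition mutexR (R : realType) (M : nat) (D : schedule_data R M) :
    {set 'I_M * 'I_M} :=
  mutex D :\: (precedence D :&: mutex D).

Definition schedule_feasible (R : realType) (M : nat) (D : schedule_data R M)
    (s : 'I_M -> R) (p : 'I_M -> 'I_M -> bool) (c : R) : Prop :=
  [/\ forall i, s i + duration D i <= c,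
      forall i j, (i, j) \in precedence D ->
        s i + duration D i + travel D i j <= s j,
      forall i, init_travel D i <= s i
    & forall i j, (i, j) \in mutexR D ->
        s j + duration D j + travel D j i - big_beta D * (p i j)%:R <= s i /\
        s i + duration D i + travel D i j - big_beta D * (1 - (p i j)%:R)
          <= s j].

Definition is_makespan (R : realType) (M : nat) (D : schedule_data R M)
    (c : R) : Prop :=
  (exists s p, schedule_feasible D s p c) /\
  (forall s p c', schedule_feasible D s p c' -> c <= c').

Definition f_NAC (R : realType) (M N : nat) (Xi : allocation M N -> R)
    (A : allocation M N) : R :=
  (Xi (alloc_root M N) - Xi A) / (Xi (alloc_root M N) - Xi (alloc_null M N)).

Definition f_TBO (R : realType) (M N : nat) (C : allocation M N -> R)
    (Cmax : R) (A : allocation M N) : R :=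
  Num.max ((C A - Cmax) / `|C (alloc_root M N) - Cmax|) 0.

Definition f_TETAM (R : realType) (M N : nat) (Xi C : allocation M N -> R)
    (Cmax alpha : R) (A : allocation M N) : R :=
  (1 - alpha) * f_NAC Xi A + alpha * f_TBO C Cmax A.

Definition remove_robot (M N : nat) (A : allocation M N) (m : 'I_M) (n : 'I_N) :
    allocation M N :=
  \matrix_(i, j) (A i j && ((i, j) != (m, n))).

Definition children (M N : nat) (A : allocation M N) : {set allocation M N} :=
  [set B | [exists m, exists n, A m n && (B == remove_robot A m n)]].

Definition best_open (R : realType) (M N : nat) (f : allocation M N -> R)
    (opn : {set allocation M N}) (A : allocation M N) : Prop :=
  A \in opn /\ (forall B, B \in opn -> f A <= f B).

(* gbfs_returns f C Cmax opn gen B: from open set opn, gen being the set of all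
   nodes generated so far, some run of the search (for some way of breaking
   ties) stops and returns B.  Reporting infeasibility (opn empty) returns
   nothing, hence has no constructor. *)
Inductive gbfs_returns (R : realType) (M N : nat) (f C : allocation M N -> R)
    (Cmax : R) (opn gen : {set allocation M N}) : allocation M N -> Prop :=
| GbfsReturn A :
    best_open f opn A -> C A <= Cmax ->
    gbfs_returns f C Cmax opn gen A
| GbfsExpand A B :
    best_open f opn A -> Cmax < C A ->
    gbfs_returns f C Cmax
      ((opn :\ A) :|: (children A :\: gen)) (gen :|: children A) B ->
    gbfs_returns f C Cmax opn gen B.

Definition eitags_solution (R : realType) (M N : nat)
    (Xi C : allocation M N -> R) (Cmax alpha : R) (A : allocation M N) : Prop :=
  gbfs_returns (f_TETAM Xi C Cmax alpha) C Cmax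
    [set alloc_root M N] [set alloc_root M N] A.

Definition optimal_allocation (R : realType) (M N : nat)
    (Xi C : allocation M N -> R) (Cmax : R) (A : allocation M N) : Prop :=
  C A <= Cmax /\ (forall B, C B <= Cmax -> Xi B <= Xi A).

(* Main.v *)
Require Import Defs.
From HB Require Import structures.
From mathcomp Require Import all_boot all_order all_algebra.
From mathcomp Require Import reals.
From mathcomp Require Import ring lra.

Set Implicit Arguments.
Unset Strict Implicit.
Unset Printing Implicit Defensive.

Import Order.TTheory GRing.Theory Num.Theory.
Local Open Scope ring_scope.

(* The search only discards nodes that exceed the time budget, and it generates
   all their children.  Hence, as long as it runs, the open set contains a
   superset B of the optimal allocation A*.  The returned allocation is at most
   as expensive as B for f_TETAM; since the over-budget term lies in [0, 1] and
   f_NAC B <= f_NAC A*, the two f_NAC values differ by at most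
   alpha / (1 - alpha). *)

Definition alloc_le (M N : nat) (A B : allocation M N) : bool :=
  [forall i, forall j, A i j ==> B i j].

Lemma alloc_leP (M N : nat) (A B : allocation M N) :
  reflect (forall i j, A i j ==> B i j) (alloc_le A B).
Proof.
by apply: (iffP forallP) => [h i j|h i]; [move: (h i) => /forallP | apply/forallP].
Qed.

Lemma alloc_le_root (M N : nat) (A : allocation M N) :
  alloc_le A (alloc_root M N).
Proof. by apply/alloc_leP => i j; rewrite mxE implybT. Qed.

Lemma alloc_null_le (M N : nat) (A : allocation M N) :
  alloc_le (alloc_null M N) A.
Proof. by apply/alloc_leP => i j; rewrite mxE. Qed.

Definition alloc_size (M N : nat) (A : allocation M N) : nat :=
  #|[set ij | A ij.1 ij.2]|.

(** Some assignment of [B] is absent from [A]; removing it yields a child that still contains [A].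
    The decrease of [alloc_size] makes descent along children well founded. *)
Lemma children_between (M N : nat) (A B : allocation M N) :
  alloc_le A B -> A != B ->
  exists B', [/\ B' \in children B, alloc_le A B'
                & (alloc_size B' < alloc_size B)%N].
Proof.
move=> /alloc_leP leAB neqAB.
have [m [n /andP[Bmn nAmn]]] : exists m n, B m n && ~~ A m n.
  case: (boolP [exists m, exists n, B m n && ~~ A m n]) => [|nex].
    by move=> /existsP[m /existsP[n h]]; exists m, n.
  case/eqP: neqAB; apply/matrixP => i j; move: (leAB i j) nex.
  rewrite negb_exists => + /forallP/(_ i); rewrite negb_exists.
  by move=> + /forallP/(_ j); case: (A i j) (B i j) => [] [].
exists (remove_robot B m n); split.
- by rewrite inE; apply/existsP; exists m; apply/existsP; exists n; rewrite Bmn eqxx.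
- apply/alloc_leP => i j; rewrite mxE; apply/implyP => Aij.
  rewrite (implyP (leAB i j) Aij) /=.
  by apply: contra nAmn => /eqP[<- <-].
- apply/proper_card/properP; split.
    by apply/subsetP => -[i j]; rewrite !inE mxE => /andP[].
  by exists (m, n); rewrite !inE // mxE eqxx andbF.
Qed.

(** Closed nodes have no set of their own: they are those in [gen] outside [opn], each already
    rejected and expanded. *)
Definition search_inv (R : realType) (M N : nat) (C : allocation M N -> R)
    (Cmax : R) (opn gen : {set allocation M N}) : Prop :=
  alloc_root M N \in gen /\
  (forall A, A \in gen -> A \notin opn ->
     Cmax < C A /\ children A \subset gen).

(** Take a generated superset [B] of [A] of least size. If [B] were closed, it would be over budget,
    hence different from [A], and one of its generated children would be a smaller superset of
    [A]. *)
Lemma search_inv_open (R : realType) (M N : nat) (C : allocation M N -> R)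
    (Cmax : R) (opn gen : {set allocation M N}) (A : allocation M N) :
  search_inv C Cmax opn gen -> C A <= Cmax ->
  exists2 B, B \in opn & alloc_le A B.
Proof.
move=> [root_gen closed_gen] CA.
have P0 : (alloc_root M N \in gen) && alloc_le A (alloc_root M N).
  by rewrite root_gen alloc_le_root.
have [B /andP[Bgen leAB] minB] :=
  @arg_minnP _ _ (fun B => (B \in gen) && alloc_le A B) (@alloc_size M N) P0.
exists B => //; apply/negPn/negP => Bopn.
have [CB childB] := closed_gen B Bgen Bopn.
have neqAB : A != B by apply: contraTneq CB => <-; rewrite -leNgt.
have [B' [B'B leAB' ltB']] := children_between leAB neqAB.
have := minB B'; rewrite (subsetP childB _ B'B) leAB' => /(_ isT).
by rewrite leqNgt ltB'.
Qed.

Lemma search_inv_expand (R : realType) (M N : nat) (C : allocation M N -> R)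
    (Cmax : R) (opn gen : {set allocation M N}) (A : allocation M N) :
  search_inv C Cmax opn gen -> Cmax < C A ->
  search_inv C Cmax ((opn :\ A) :|: (children A :\: gen))
    (gen :|: children A).
Proof.
move=> [root_gen closed_gen] CA; split; first by rewrite in_setU root_gen.
move=> B; rewrite in_setU => Bgen.
rewrite !(in_setU, in_setD, in_set1) negb_or !negb_and !negbK.
case: (eqVneq B A) => [-> _|_ /= /andP[Bopn nBA]].
  by split=> //; apply: subsetUr.
(* A child of [A] that was not in [gen] has just been opened, so a closed [B] other than [A] was
   generated earlier. *)
have {}Bgen : B \in gen by case/orP: Bgen nBA => // -> /orP[].
have [CB childB] := closed_gen B Bgen Bopn.
by split=> //; apply: subset_trans childB (subsetUl _ _).
Qed.

(** Expansions only have to preserve the invariant. Minimality of [f] is used once, at the returning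
    step, against the superset of [A] that is open at that moment; so [f] can be arbitrary. *)
Lemma gbfs_returns_sound (R : realType) (M N : nat) (f C : allocation M N -> R)
    (Cmax : R) (opn gen : {set allocation M N}) (A B : allocation M N) :
  search_inv C Cmax opn gen -> C A <= Cmax ->
  gbfs_returns f C Cmax opn gen B ->
  C B <= Cmax /\ exists2 B', alloc_le A B' & f B <= f B'.
Proof.
move=> inv CA run; elim: run inv => {opn gen B}
  [opn gen B [_ minB] CB|opn gen B B' _ CB _ IH] inv.
  have [B' B'opn leAB'] := search_inv_open inv CA.
  by split=> //; exists B' => //; apply: minB.
exact/IH/search_inv_expand.
Qed.

Lemma total_efficacy_mono (R : realType) (M N U : nat) (Q : 'M[R]_(N, U))
    (xi : 'I_M -> 'cV[R]_U -> R) (A B : allocation M N) :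
  (forall m (v w : 'rV[bool]_N), (forall n, v 0 n ==> w 0 n) ->
     xi m (coalition_traits Q v) <= xi m (coalition_traits Q w)) ->
  alloc_le A B -> total_efficacy Q xi A <= total_efficacy Q xi B.
Proof.
move=> xi_mono /alloc_leP leAB; apply: ler_sum => m _.
by apply: xi_mono => n; rewrite !mxE.
Qed.

Lemma f_TBO_ge0 (R : realType) (M N : nat) (C : allocation M N -> R)
    (Cmax : R) (A : allocation M N) :
  0 <= f_TBO C Cmax A.
Proof. by rewrite /f_TBO le_max lexx orbT. Qed.

Lemma f_TBO_le1 (R : realType) (M N : nat) (C : allocation M N -> R)
    (Cmax : R) (A : allocation M N) :
  C A <= C (alloc_root M N) -> C (alloc_root M N) != Cmax ->
  f_TBO C Cmax A <= 1.
Proof.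
move=> CA neqC; rewrite /f_TBO ge_max ler01 andbT.
rewrite ler_pdivrMr ?normr_gt0 ?subr_eq0 // mul1r.
(* The absolute value in the denominator makes this bound independent of the sign of
   [C (alloc_root M N) - Cmax]. *)
by apply: le_trans (ler_norm _); rewrite lerD2r.
Qed.

Theorem theorem1 (R : realType) (M N U : nat)
    (Q : 'M[R]_(N, U)) (xi : 'I_M -> 'cV[R]_U -> R)
    (D : allocation M N -> schedule_data R M)
    (C : allocation M N -> R) (Cmax alpha : R)
    (Astar Ahat : allocation M N)
    (Q_ge0 : forall n u, 0 <= Q n u)
    (xi_range : forall m (y : 'cV[R]_U),
      (forall u, 0 <= y u 0) -> 0 <= xi m y <= 1)
    (xi_mono : forall m (v w : 'rV[bool]_N),
      (forall n, v 0 n ==> w 0 n) ->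
      xi m (coalition_traits Q v) <= xi m (coalition_traits Q w))
    (beta_gt0 : forall A, 0 < big_beta (D A))
    (C_makespan : forall A, is_makespan (D A) (C A))
    (C_worst : forall A, C A <= C (alloc_root M N))
    (Xi_neq : total_efficacy Q xi (alloc_root M N)
              != total_efficacy Q xi (alloc_null M N))
    (C_neq : C (alloc_root M N) != Cmax)
    (Astar_opt : optimal_allocation (total_efficacy Q xi) C Cmax Astar)
    (Ahat_sol : eitags_solution (total_efficacy Q xi) C Cmax alpha Ahat)
    (alpha_ge0 : 0 <= alpha) (alpha_lt : alpha < 1 / 2) :
  total_efficacy Q xi Astar - total_efficacy Q xi Ahat
    <= alpha / (1 - alpha)
       * (total_efficacy Q xi (alloc_root M N)
          - total_efficacy Q xi (alloc_null M N))
  /\ (alpha = 0 ->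
      total_efficacy Q xi Astar - total_efficacy Q xi Ahat = 0).
Proof.
set Xi := total_efficacy Q xi.
have Xi_mono A B : alloc_le A B -> Xi A <= Xi B by exact: total_efficacy_mono.
case: Astar_opt => CAstar maxAstar.
(* Initially the only generated node is open, so the condition on closed nodes is vacuous. *)
have inv0 : search_inv C Cmax [set alloc_root M N] [set alloc_root M N].
  by split=> [|A ->//]; rewrite set11.
have [CAhat [B leAB]] := gbfs_returns_sound inv0 CAstar Ahat_sol.
have leXi := Xi_mono _ _ leAB.
set gap := Xi (alloc_root M N) - Xi (alloc_null M N).
have gap_gt0 : 0 < gap.
  by rewrite subr_gt0 lt_neqAle eq_sym Xi_neq Xi_mono ?alloc_null_le.
have alpha1_gt0 : 0 < 1 - alpha by lra.
rewrite /f_TETAM /f_NAC -/Xi -/gap => le_f.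
have hat_ge0 := mulr_ge0 alpha_ge0 (f_TBO_ge0 C Cmax Ahat).
have B_le1 := ler_wpM2l alpha_ge0 (f_TBO_le1 (C_worst B) C_neq).
have bound : Xi Astar - Xi Ahat <= alpha / (1 - alpha) * gap.
  apply: (@le_trans _ _ (Xi B - Xi Ahat)); first by rewrite lerD2r.
  (* Clearing both positive denominators leaves [1 - alpha] times the difference of the [f_NAC]
     values of [Ahat] and [B], to be bounded by [alpha]. This is linear in the products occurring in
     [le_f], [hat_ge0] and [B_le1]. *)
  rewrite -ler_pdivrMr // ler_pdivlMr // mulrC.
  have -> : Xi B - Xi Ahat = (Xi (alloc_root M N) - Xi Ahat)
                             - (Xi (alloc_root M N) - Xi B) by ring.
  rewrite [(_ - _) / gap]mulrBl mulrBr; lra.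
(* For [alpha = 0] the bound gives one inequality; the other is optimality of [Astar] against
   [Ahat], which is within budget. *)
split=> // alpha0; apply: le_anti; rewrite subr_ge0 maxAstar // andbT.
by move: bound; rewrite alpha0 !mul0r.
Qed.
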